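(* For every commutative unital $f$-ring $A$, there is an Abelian $\ell$-group $G$ with order-unit such that the Brumfiel spectrum of $A$ is (up to homeomorphism) a spectral subspace of the $\ell$-spectrum of $G$. Consequently, for every commutative unital ring $R$, the real spectrum of $R$ is (up to homeomorphism) a spectral subspace of the $\ell$-spectrum of some Abelian $\ell$-group with order-unit.
   Context: ''Compact'' does not include Hausdorff. A topological space is sober if every join-irreducible member of the lattice of its closed subsets is the closure of a unique singleton. It is generalized spectral if it is sober, its compact open subsets form a basis, and the intersection of any two compact open subsets is compact; it is spectral if moreover it is compact. A map between topological spaces is spectral if the inverse image of every compact open set is compact open. A generalized spectral space $X$ is a spectral subspace of a generalized spectral space $Y$ if $X\subseteq Y$, $X$ carries the topology induced by $Y$, and the inclusion map $X\to Y$ is spectral. An $\ell$-group is a group with a translation-invariant lattice ordering. An $\ell$-ideal of an Abelian $\ell$-group $G$ is a subgroup that is also an order-convex sublattice. A prime $\ell$-ideal is a proper $\ell$-ideal $P$ such that $x\wedge y\in P$ implies $x\in P$ or $y\in P$. The $\ell$-spectrum of $G$ is the set of all prime $\ell$-ideals of $G$, with closed sets exactly the sets $\{P : I\subseteq P\}$ for $I\subseteq G$. A lattice-ordered ring is a ring (not necessarily unital) with a lattice ordering invariant under additive translations and preserved by multiplication by positive elements; it is an $f$-ring if for all $x,y,z\geq 0$, $x\wedge y=0$ implies $x\wedge yz=x\wedge zy=0$. An $\ell$-ideal of an $f$-ring is a ring ideal that is also an order-convex sublattice. A prime $\ell$-ideal of a commutative $f$-ring is a proper $\ell$-ideal $P$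 that is prime as a ring ideal ($xy\in P$ implies $x\in P$ or $y\in P$). The Brumfiel spectrum of a commutative $f$-ring $A$ is the set of all its prime $\ell$-ideals, with closed sets exactly the sets $\{P: I\subseteq P\}$ for $I\subseteq A$. For a commutative unital ring $R$, a cone is a subset that is both an additive and a multiplicative submonoid of $R$ and contains all squares. A cone $P$ is prime if $R=P\cup(-P)$ and $P\cap(-P)$ is a prime ideal of $R$. The real spectrum of $R$ is the set of all prime cones of $R$, with the topology generated by the sets $\{P : a\notin P\}$, $a\in R$. *)

(* Defs.v *)
From HB Require Import structures.
From mathcomp Require Import all_boot all_order all_algebra.
From mathcomp Require Import all_classical topology.

Set Implicit Arguments.
Unset Strict Implicit.
Unset Printing Implicit Defensive.

Import Order.TTheory GRing.Theory Num.Theory.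

Local Open Scope classical_set_scope.
Local Open Scope ring_scope.

(* HB cannot declare the structures "Zmodule with a lattice order" and "PzRing
   with a lattice order" once Num.RealDomain and Num.NumDomain exist (they are
   missing joins below these).  They are therefore records, whose carriers
   are then equipped with the algebraic and order structures of the library. *)

Record lattice_order (T : Type) : Type := LatticeOrder {
  lo_le : rel T;
  lo_meet : T -> T -> T;
  lo_join : T -> T -> T;
  lo_refl : reflexive lo_le;
  lo_anti : antisymmetric lo_le;
  lo_trans : transitive lo_le;
  lo_lexI : forall x y z, lo_le x (lo_meet y z) = lo_le x y && lo_le x z;
  lo_leUx : forall x y z, lo_le (lo_join x y) z = lo_le x z && lo_le y z
}.

Record abLGroupType : Type := AbLGroup {
  ablgroup_zmod : zmodType;
  ablgroup_order : lattice_order ablgroup_zmod;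
  ablgroup_leD2l : forall x y z : ablgroup_zmod,
    lo_le ablgroup_order y z -> lo_le ablgroup_order (x + y) (x + z)
}.

Definition ablgroup_sort (G : abLGroupType) : Type := ablgroup_zmod G.
Coercion ablgroup_sort : abLGroupType >-> Sortclass.

HB.instance Definition _ (G : abLGroupType) :=
  GRing.Zmodule.copy (ablgroup_sort G) (ablgroup_zmod G).
HB.instance Definition _ (G : abLGroupType) :=
  Order.Le_isPOrder.Build ring_display (ablgroup_sort G)
    (lo_refl (ablgroup_order G)) (@lo_anti _ (ablgroup_order G))
    (@lo_trans _ (ablgroup_order G)).
HB.instance Definition _ (G : abLGroupType) :=
  Order.POrder_isMeetSemilattice.Build ring_display (ablgroup_sort G)
    (lo_lexI (ablgroup_order G)).
HB.instance Definition _ (G : abLGroupType) :=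
  Order.POrder_isJoinSemilattice.Build ring_display (ablgroup_sort G)
    (lo_leUx (ablgroup_order G)).

Lemma lgroup_leD2l (G : abLGroupType) (x y z : G) : y <= z -> x + y <= x + z.
Proof. exact: ablgroup_leD2l. Qed.

(* Commutative unital f-rings.  The zero ring is allowed; by commutativity the
   one-sided conditions below are the two-sided ones. *)
Record comFRingType : Type := ComFRing {
  fring_ring : comPzRingType;
  fring_order : lattice_order fring_ring;
  fring_orderD2l : forall x y z : fring_ring,
    lo_le fring_order y z -> lo_le fring_order (x + y) (x + z);
  fring_orderM2l : forall x y z : fring_ring,
    lo_le fring_order 0 x -> lo_le fring_order y z ->
    lo_le fring_order (x * y) (x * z);
  fring_orderIM : forall x y z : fring_ring,
    lo_le fring_order 0 x -> lo_le fring_order 0 y -> lo_le fring_order 0 z ->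
    lo_meet fring_order x y = 0 -> lo_meet fring_order x (y * z) = 0
}.

Definition fring_sort (A : comFRingType) : Type := fring_ring A.
Coercion fring_sort : comFRingType >-> Sortclass.

HB.instance Definition _ (A : comFRingType) :=
  GRing.ComPzRing.copy (fring_sort A) (fring_ring A).
HB.instance Definition _ (A : comFRingType) :=
  Order.Le_isPOrder.Build ring_display (fring_sort A)
    (lo_refl (fring_order A)) (@lo_anti _ (fring_order A))
    (@lo_trans _ (fring_order A)).
HB.instance Definition _ (A : comFRingType) :=
  Order.POrder_isMeetSemilattice.Build ring_display (fring_sort A)
    (lo_lexI (fring_order A)).
HB.instance Definition _ (A : comFRingType) :=
  Order.POrder_isJoinSemilattice.Build ring_display (fring_sort A)
    (lo_leUx (fring_order A)).

Lemma fring_leD2l (A : comFRingType) (x y z : A) : y <= z -> x + y <= x + z.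
Proof. exact: fring_orderD2l. Qed.

Lemma fring_leM2l (A : comFRingType) (x y z : A) :
  0 <= x -> y <= z -> x * y <= x * z.
Proof. exact: fring_orderM2l. Qed.

Lemma fring_meetM (A : comFRingType) (x y z : A) : 0 <= x -> 0 <= y -> 0 <= z ->
  Order.meet x y = 0 -> Order.meet x (y * z) = 0.
Proof. exact: fring_orderIM. Qed.

Definition order_unit (G : abLGroupType) (u : G) : Prop :=
  0 <= u /\ forall x : G, exists n : nat, x <= u *+ n.

Record subgroup (G : zmodType) (I : set G) : Prop := {
  subgroup0 : I 0;
  subgroupB : forall x y, I x -> I y -> I (x - y)
}.

Record ring_ideal (R : comPzRingType) (I : set R) : Prop := {
  ring_ideal_subgroup : subgroup I;
  ring_idealM : forall x y, I y -> I (x * y)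
}.

Record prime_ring_ideal (R : comPzRingType) (I : set R) : Prop := {
  prime_ring_ideal_ideal : ring_ideal I;
  prime_ring_ideal_proper : I <> setT;
  prime_ring_idealM : forall x y, I (x * y) -> I x \/ I y
}.

Record convex_sublattice d (L : latticeType d) (I : set L) : Prop := {
  convex_sublattice_meet : forall x y, I x -> I y -> I (Order.meet x y);
  convex_sublattice_join : forall x y, I x -> I y -> I (Order.join x y);
  convex_sublattice_convex :
    forall x y z, I x -> I z -> (x <= y)%O -> (y <= z)%O -> I y
}.

Record lgroup_ideal (G : abLGroupType) (I : set G) : Prop := {
  lgroup_ideal_subgroup : subgroup I;
  lgroup_ideal_convex : convex_sublattice I
}.

Record prime_lgroup_ideal (G : abLGroupType) (P : set G) : Prop := {
  prime_lgroup_ideal_ideal : lgroup_ideal P;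
  prime_lgroup_ideal_proper : P <> setT;
  prime_lgroup_ideal_meet : forall x y, P (Order.meet x y) -> P x \/ P y
}.

Record fring_ideal (A : comFRingType) (I : set A) : Prop := {
  fring_ideal_ideal : ring_ideal I;
  fring_ideal_convex : convex_sublattice I
}.

Record prime_fring_ideal (A : comFRingType) (P : set A) : Prop := {
  prime_fring_ideal_ideal : fring_ideal P;
  prime_fring_ideal_proper : P <> setT;
  prime_fring_idealM : forall x y, P (x * y) -> P x \/ P y
}.

Record cone (R : comPzRingType) (P : set R) : Prop := {
  cone0 : P 0;
  coneD : forall x y, P x -> P y -> P (x + y);
  cone1 : P 1;
  coneM : forall x y, P x -> P y -> P (x * y);
  cone_sqr : forall x, P (x ^+ 2)
}.

Record prime_cone (R : comPzRingType) (P : set R) : Prop := {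
  prime_cone_cone : cone P;
  prime_cone_total : P `|` [set - x | x in P] = setT;
  prime_cone_support : prime_ring_ideal (P `&` [set - x | x in P])
}.

Section HullKernel.
Context (A X : Type) (m : X -> set A).

(* The complements of the sets {P | I \subset P}. *)
Definition hull_kernel_open : set (set X) :=
  [set U | exists I : set A, U = ~` [set P | I `<=` m P]].

Lemma hull_kernel_openP (U : set X) :
  (forall P, U P -> exists2 k, ~ m P k & forall Q, ~ m Q k -> U Q) ->
  hull_kernel_open U.
Proof.
move=> h; exists [set k | forall Q, ~ m Q k -> U Q].
rewrite eqEsubset; split=> P.
  by move=> /h [k nk kU] /(_ k kU).
by move=> /= nI; apply: contrapT => nU; apply: nI => k kU; apply: contrapT => /kU.
Qed.

Lemma hull_kernel_openE (U : set X) P : hull_kernel_open U -> U P ->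
  exists2 k, ~ m P k & forall Q, ~ m Q k -> U Q.
Proof.
move=> [I ->] /= nI; have [k [Ik nk]] : exists k, I k /\ ~ m P k.
  apply: contrapT => nex; apply: nI => k Ik; apply: contrapT => nk.
  by apply: nex; exists k.
by exists k => // Q nQ IQ; exact/nQ/IQ.
Qed.

Lemma hull_kernel_openT : (forall P, m P <> setT) -> hull_kernel_open setT.
Proof.
move=> prop; exists setT; rewrite eqEsubset; split=> // P _ /= TP.
by apply: (prop P); rewrite eqEsubset.
Qed.

Lemma hull_kernel_openI :
  (forall P a b, ~ m P a -> ~ m P b -> exists2 k, ~ m P k &
    forall Q, ~ m Q k -> ~ m Q a /\ ~ m Q b) -> setI_closed hull_kernel_open.
Proof.
move=> h U V oU oV; apply: hull_kernel_openP => P [UP VP].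
have [a na aU] := hull_kernel_openE oU UP.
have [b nb bV] := hull_kernel_openE oV VP.
by have [k nk kab] := h P a b na nb; exists k => // Q /kab [/aU ? /bV].
Qed.

Lemma hull_kernel_open_bigU (I : Type) (f : I -> set X) :
  (forall i, hull_kernel_open (f i)) -> hull_kernel_open (\bigcup_i f i).
Proof.
move=> h; apply: hull_kernel_openP => P [i _ fiP].
have [k nk kf] := hull_kernel_openE (h i) fiP.
by exists k => // Q /kf; exists i.
Qed.

End HullKernel.

Record lspectrum (G : abLGroupType) : Type := LSpectrum {
  lspectrum_set :> set G;
  lspectrumP : prime_lgroup_ideal lspectrum_set
}.

HB.instance Definition _ G := gen_eqMixin (lspectrum G).
HB.instance Definition _ G := gen_choiceMixin (lspectrum G).

Section LSpectrumTopology.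
Variable G : abLGroupType.
Local Notation "P \contains x" := (lspectrum_set P x) (at level 60).

Let proper (P : lspectrum G) : (P : set G) <> setT.
Proof. exact: prime_lgroup_ideal_proper (lspectrumP P). Qed.

Let positive_witness (P : lspectrum G) (a : G) : ~ P \contains a ->
  exists2 c : G, ~ P \contains c &
    0 <= c /\ forall Q : lspectrum G, Q \contains a -> Q \contains c.
Proof.
move=> nPa; have [[[P0 PB] [Pm Pj Pc]] _ _] := lspectrumP P.
have [Pa|] := pselect (P \contains Order.join a 0); last first.
  exists (Order.join a 0) => //; split=> [|Q Qa]; first exact: leUr.
  by have [[[Q0 _] [_ Qj _]] _ _] := lspectrumP Q; apply: Qj.
exists (Order.join (- a) 0).
  move=> Pa'; apply: nPa; apply: (Pc (0 - Order.join (- a) 0) _ _ _ Pa).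
  - exact: PB.
  - have := lgroup_leD2l (a - Order.join (- a) 0) (leUl (- a) (0 : G)).
    by rewrite sub0r addrAC subrr add0r subrK.
  - exact: leUl.
split=> [|Q Qa]; first exact: leUr.
have [[[Q0 QB] [_ Qj _]] _ _] := lspectrumP Q.
by apply: Qj => //; rewrite -sub0r; exact: QB.
Qed.

Let common_witness (P : lspectrum G) (a b : G) : ~ P \contains a -> ~ P \contains b ->
  exists2 k : G, ~ P \contains k &
    forall Q : lspectrum G, ~ Q \contains k -> ~ Q \contains a /\ ~ Q \contains b.
Proof.
move=> /positive_witness [c nc [c0 ca]] /positive_witness [d nd [d0 db]].
have [_ _ Pp] := lspectrumP P.
exists (Order.meet c d); first by move=> /Pp [].
move=> Q nQ; have [[[Q0 _] [_ _ Qc]] _ _] := lspectrumP Q.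
have m0 : 0 <= Order.meet c d by rewrite lexI c0 d0.
split=> [/ca Qx|/db Qx]; apply: nQ.
  by apply: (Qc 0 _ c) => //; exact: leIl.
by apply: (Qc 0 _ d) => //; exact: leIr.
Qed.

HB.instance Definition _ := isOpenTopological.Build (lspectrum G)
  (hull_kernel_openT proper) (hull_kernel_openI common_witness)
  (@hull_kernel_open_bigU _ _ (@lspectrum_set G)).

Lemma lspectrum_closedE (F : set (lspectrum G)) :
  closed F <-> exists I : set G, F = [set P : lspectrum G | I `<=` P].
Proof.
rewrite -openC; split=> -[I]; last by move=> ->; exists I.
by move=> /(congr1 setC); rewrite !setCK => ->; exists I.
Qed.

End LSpectrumTopology.

Record brumfiel_spectrum (A : comFRingType) : Type := BrumfielSpectrum {
  brumfiel_spectrum_set :> set A;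
  brumfiel_spectrumP : prime_fring_ideal brumfiel_spectrum_set
}.

HB.instance Definition _ A := gen_eqMixin (brumfiel_spectrum A).
HB.instance Definition _ A := gen_choiceMixin (brumfiel_spectrum A).

Section BrumfielSpectrumTopology.
Variable A : comFRingType.
Local Notation "P \contains x" := (brumfiel_spectrum_set P x) (at level 60).

Let proper (P : brumfiel_spectrum A) : (P : set A) <> setT.
Proof. exact: prime_fring_ideal_proper (brumfiel_spectrumP P). Qed.

Let common_witness (P : brumfiel_spectrum A) (a b : A) :
  ~ P \contains a -> ~ P \contains b ->
  exists2 k : A, ~ P \contains k &
    forall Q : brumfiel_spectrum A, ~ Q \contains k -> ~ Q \contains a /\ ~ Q \contains b.
Proof.
move=> nPa nPb; have [_ _ Pp] := brumfiel_spectrumP P.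
exists (a * b); first by move=> /Pp [].
move=> Q nQ; have [[[_ QM] _] _ _] := brumfiel_spectrumP Q.
by split=> Qx; apply: nQ; [rewrite mulrC|]; exact: QM.
Qed.

HB.instance Definition _ := isOpenTopological.Build (brumfiel_spectrum A)
  (hull_kernel_openT proper) (hull_kernel_openI common_witness)
  (@hull_kernel_open_bigU _ _ (@brumfiel_spectrum_set A)).

Lemma brumfiel_spectrum_closedE (F : set (brumfiel_spectrum A)) :
  closed F <-> exists I : set A, F = [set P : brumfiel_spectrum A | I `<=` P].
Proof.
rewrite -openC; split=> -[I]; last by move=> ->; exists I.
by move=> /(congr1 setC); rewrite !setCK => ->; exists I.
Qed.

End BrumfielSpectrumTopology.

Record real_spectrum (R : comPzRingType) : Type := RealSpectrum {
  real_spectrum_set :> set R;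
  real_spectrumP : prime_cone real_spectrum_set
}.

HB.instance Definition _ R := gen_eqMixin (real_spectrum R).
HB.instance Definition _ R := gen_choiceMixin (real_spectrum R).

(* The subbase is indexed by itself because the index type of
   [isSubBaseTopological] has to be pointed. *)
HB.instance Definition _ (R : comPzRingType) :=
  isSubBaseTopological.Build (real_spectrum R)
    [set U | exists a : R,
       U = [set P : real_spectrum R | ~ real_spectrum_set P a]] id.

Section SpectralSpaces.
Implicit Types X Y : topologicalType.

(* The bottom element set0 of the lattice of closed sets is not
   join-irreducible. *)
Definition join_irreducible_closed X (F : set X) : Prop :=
  [/\ closed F, F <> set0 &
      forall A B : set X, closed A -> closed B ->
        F = A `|` B -> F = A \/ F = B].

Definition sober X : Prop :=
  forall F : set X, join_irreducible_closed F ->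
    exists! x : X, F = closure [set x].

Definition compact_open_set X : set (set X) := [set K | compact K /\ open K].

Record generalized_spectral X : Prop := {
  generalized_spectral_sober : sober X;
  generalized_spectral_basis : basis (@compact_open_set X);
  generalized_spectral_compactI : setI_closed (@compact_open_set X)
}.

Definition spectral_map X Y (f : X -> Y) : Prop :=
  forall K : set Y, compact_open_set K -> compact_open_set (f @^-1` K).

(* [set_type Z] carries the topology induced by [Y]. *)
Record spectral_subspace Y (Z : set Y) : Prop := {
  spectral_subspace_ambient : generalized_spectral Y;
  spectral_subspace_sub : generalized_spectral (set_type Z);
  spectral_subspace_incl : spectral_map (set_val : set_type Z -> Y)
}.

Definition homeomorphic X Y : Prop :=
  exists (f : X -> Y) (g : Y -> X),
    [/\ cancel f g, cancel g f, continuous f & continuous g].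

Definition spectral_subspace_upto_homeo X Y : Prop :=
  exists2 Z : set Y, spectral_subspace Z & homeomorphic X (set_type Z).

End SpectralSpaces.

(* Main.v *)
(* In both cases the points of the spectrum X are total preorders, compatible
   with the addition, on a fixed abelian group M (the additive group of the
   ring): a prime cone is itself such a preorder, and a prime l-ideal P of A
   gives the preimage of the positive cone of the totally ordered ring A / P.
   Moreover X is closed in the product space 2 ^ M, and its topology is generated
   by the sets of points at which a given element is negative.  Let G be the
   l-group of all functions on X, with value at x in M modulo the support of x,
   that are joins of meets of finitely many elements of M and are bounded by a
   multiple of 1.  Sending x to { f in G | f x = 0 } embeds X into the l-spectrum
   of G; the truncation at 1 of the positive part of - a does not vanish exactly
   where a is negative, and conversely the cozero set of an element of G is a
   finite union of finite intersections of such sets.  The l-spectrum of an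
   l-group with order-unit is closed in 2 ^ G, just as X is closed in 2 ^ M.
   Spaces of this kind are spectral: their compact open sets are the open sets
   that are closed for the product topology. *)

Require Import Defs.
From HB Require Import structures.
From mathcomp Require Import all_boot all_order all_algebra.
From mathcomp Require Import all_classical finmap topology.

Set Implicit Arguments.
Unset Strict Implicit.
Unset Printing Implicit Defensive.

Import Order.TTheory GRing.Theory.

Local Open Scope classical_set_scope.
Local Open Scope ring_scope.

(** * Ultrafilters and Boolean operations *)

Lemma ultra_fmap (T U : Type) (f : T -> U) (F : set_system T) :
  UltraFilter F -> UltraFilter (f @ F).
Proof.
move=> FU; split=> [|G GF sFG]; first exact: fmap_proper_filter.
rewrite eqEsubset; split=> // A GA.
have [//|nA] := in_ultra_setVsetC (f @^-1` A) FU.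
have /filter_ex[y [] //] : G (A `&` ~` A) by apply: filterI => //; exact: sFG.
Qed.

Lemma ultra_setC (T : Type) (F : set_system T) (B : set T) :
  UltraFilter F -> F (~` B) <-> ~ F B.
Proof.
move=> FU; split=> [nB FB|nB]; last by case: (in_ultra_setVsetC B FU).
by have [y []] := filter_ex (filterI FB nB).
Qed.

Lemma ultra_setU (T : Type) (F : set_system T) (B C : set T) :
  UltraFilter F -> F (B `|` C) -> F B \/ F C.
Proof.
move=> FU FBC; have [|nB] := in_ultra_setVsetC B FU; first by left.
by right; apply: filterS (filterI FBC nB) => y [[]].
Qed.

Lemma filter_forall_seq (T : Type) (I : eqType) (F : set_system T) (s : seq I)
    (B : I -> set T) : Filter F -> (forall i, i \in s -> F (B i)) ->
  F [set y | forall i, i \in s -> B i y].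
Proof.
move=> FF; elim: s => [|i s IHs] h; first exact: filterS filterT.
apply: filterS (filterI (h i (mem_head _ _)) (IHs _)) => [y [Biy sy] j|j js].
  by rewrite inE => /predU1P[->|/sy].
by apply: h; rewrite inE js orbT.
Qed.

(** * Closed subspaces of power sets *)

Section PatchSpace.
Context (A : eqType) (X : topologicalType) (m : X -> set A).

(** For an ultrafilter, this is convergence in the topology pulled back by [m] from the product
    [2 ^ A]; the coordinatewise form avoids a second topology on [X]. *)
Definition patch_limit (F : set_system X) (x : X) : Prop :=
  forall a, m x a <-> F [set y | m y a].

Definition patch_closed (K : set X) : Prop :=
  forall F x, UltraFilter F -> F K -> patch_limit F x -> K x.

(* [m] identifies [X] with a subspace of the power set of [A] that is closed for
   the product topology of [2 ^ A] (the patch topology), the topology of [X]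
   being generated by the sets [x | ~ m x a]. *)
Record patch_space : Prop := {
  patch_open : forall a, open [set x | ~ m x a];
  patch_subbase : forall (V : set X) x, open V -> V x ->
    exists2 s : seq A, (forall a, a \in s -> ~ m x a) &
      forall y, (forall a, a \in s -> ~ m y a) -> V y;
  patch_limit_ex : forall F, UltraFilter F -> exists x, patch_limit F x;
  patch_inj : injective m
}.

Hypothesis pX : patch_space.

(** A basic open set is cut out by finitely many conditions [~ m y a], and each one true at [x]
    holds [F]-almost everywhere. *)
Lemma patch_limit_open (F : set_system X) (x : X) (V : set X) :
  UltraFilter F -> patch_limit F x -> open V -> V x -> F V.
Proof.
move=> FU Fx oV Vx; have [s nsx sV] := patch_subbase pX oV Vx.
apply: filterS (sV : [set y | _] `<=` V) _.
apply: filter_forall_seq => a /nsx nax.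
by apply/(@ultra_setC _ _ [set y | m y a]) => /Fx.
Qed.

Lemma patch_closed_notin (a : A) : patch_closed [set x | ~ m x a].
Proof.
move=> F x FU Fa Fx /Fx Fma.
by have [y []] := filter_ex (filterI Fa Fma).
Qed.

Lemma patch_closedI : setI_closed patch_closed.
Proof.
by move=> K L cK cL F x FU FKL Fx; split; [apply: cK Fx|apply: cL Fx];
  apply: filterS FKL => y [].
Qed.

Lemma patch_closedU (K L : set X) :
  patch_closed K -> patch_closed L -> patch_closed (K `|` L).
Proof.
move=> cK cL F x FU /ultra_setU[FK|FL] Fx; first by left; apply: cK Fx.
by right; apply: cL Fx.
Qed.

(** If [K] is compact, [F] converges to some [y] in [K], and the patch limit [x] lies in every basic
    neighbourhood of [y]. Conversely, a patch limit is a limit in the coarser topology of [X]. *)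
Lemma patch_compact_openE (K : set X) :
  compact_open_set K <-> open K /\ patch_closed K.
Proof.
rewrite /compact_open_set /= compact_ultra; split=> [[cK oK]|[oK cK]]; split=> //.
  move=> F x FU FK Fx; have [y [Ky Fy]] := cK F FU FK.
  have [s nsy sK] := patch_subbase pX oK Ky.
  apply: sK => a /nsy nay /Fx Fa.
  have /filter_ex[z [] //] : F ([set y | m y a] `&` [set y | ~ m y a]).
  apply: filterI => //; apply: Fy.
  by apply: open_nbhs_nbhs; split=> //; exact: patch_open.
move=> F FU FK; have [x Fx] := patch_limit_ex pX FU.
exists x; split; first exact: cK Fx.
move=> V; rewrite /= nbhsE => -[W [oW Wx] WV].
by apply: filterS WV _; exact: patch_limit_open Fx oW Wx.
Qed.

Lemma patch_basis (V : set X) (x : X) : open V -> V x ->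
  exists K, [/\ compact_open_set K, K x & K `<=` V].
Proof.
move=> oV Vx; have [s nsx sV] := patch_subbase pX oV Vx.
exists [set y | forall a, a \in s -> ~ m y a]; split=> //.
elim: s {sV nsx} => [|a s IHs]; apply/patch_compact_openE.
  rewrite [X in open X](_ : _ = setT); last by rewrite eqEsubset.
  by split=> [|? ? ? ?]; first exact: openT.
have -> : [set y | forall b, b \in a :: s -> ~ m y b] =
    [set y | ~ m y a] `&` [set y | forall b, b \in s -> ~ m y b].
  rewrite eqEsubset; split=> y /= => [h|[nay sy] b].
    by split=> [|b bs]; apply: h; rewrite inE ?eqxx// bs orbT.
  by rewrite inE => /predU1P[->|/sy].
have [oK cK] := (patch_compact_openE _).1 IHs.
split; first by apply: openI => //; exact: patch_open.
by apply: patch_closedI => //; exact: patch_closed_notin.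
Qed.

(* The generic point of [F] is a patch limit of the traces on [F] of the open
   sets that meet [F]. *)
Lemma patch_sober : sober X.
Proof.
move=> F [clF F0 irrF].
have [z0 Fz0] : F !=set0 by apply/set0P/eqP.
(* Otherwise [F] would be the union of two proper closed subsets. *)
have meet_opens (V W : set X) : open V -> open W -> F `&` V !=set0 ->
    F `&` W !=set0 -> F `&` (V `&` W) !=set0.
  move=> oV oW [v [Fv Vv]] [w [Fw Ww]]; apply: contrapT => VW0.
  have : F = (F `&` ~` V) `|` (F `&` ~` W).
    rewrite -setIUr -setCI eqEsubset; split=> [y Fy|y []//]; split=> // VWy.
    by apply: VW0; exists y.
  case/irrF => [| |FV|FW]; try (apply: closedI => //; exact: open_closedC).
    by move: Fv; rewrite FV => -[].
  by move: Fw; rewrite FW => -[].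
pose T := filter_from [set V | open V /\ F `&` V !=set0] (fun V => F `&` V).
have TF : ProperFilter T.
  apply: filter_from_proper => [|V []//]; apply: filter_from_filter.
    by exists setT; split; [exact: openT|exists z0].
  move=> V W [oV FV] [oW FW]; exists (V `&` W); last by rewrite setIACA setIid.
  by split; [exact: openI|exact: meet_opens].
have [U [UU TU]] := ultraFilterLemma TF.
have [x Ux] := patch_limit_ex pX UU.
have Fx : F x.
  apply: contrapT => nFx.
  have UnF := patch_limit_open UU Ux (closed_openC clF) nFx.
  have UF : U F.
    by apply: TU; exists setT; [split; [exact: openT|exists z0]|move=> ? []].
  by have [y []] := filter_ex (filterI UF UnF).
(* Shrinking [V] to a compact open [K] gives a patch closed set, so membership passes to the limit
   [x]. *)
have xF (V : set X) : open V -> F `&` V !=set0 -> V x.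
  move=> oV [y [Fy Vy]]; have [K [coK Ky KV]] := patch_basis oV Vy.
  have [oK cK] := (patch_compact_openE _).1 coK.
  apply: KV; apply: cK Ux => //; apply: TU.
  by exists K; [split=> //; exists y|move=> ? []].
have FE : F = closure [set x].
  rewrite eqEsubset; split.
    move=> y Fy V; rewrite nbhsE => -[W [oW Wy] WV].
    by exists x; split=> //; apply: WV; apply: xF => //; exists y.
  by rewrite [X in _ `<=` X](closure_id F).1 //; apply: closure_subset => y ->.
exists x; split=> // y FE'; apply: (patch_inj pX).
have sep (u v : X) a : closure [set u] v -> m u a -> m v a.
  move=> uv mua; apply: contrapT => nva.
  have /uv[w [-> //]] : nbhs v [set y | ~ m y a].
  by apply: open_nbhs_nbhs; split=> //; exact: patch_open.
rewrite eqEsubset; split=> a; apply: sep.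
  by rewrite -FE FE'; apply: subset_closure.
by rewrite -FE' FE; apply: subset_closure.
Qed.

Lemma patch_generalized_spectral : generalized_spectral X.
Proof.
split.
- exact: patch_sober.
- split=> [K []//|x V]; rewrite nbhsE => -[W [oW Wx] WV].
  have [K [coK Kx KW]] := patch_basis oW Wx.
  by exists K => //; exact: subset_trans WV.
- move=> K L /patch_compact_openE[oK cK] /patch_compact_openE[oL cL].
  apply/patch_compact_openE; split; first exact: openI.
  exact: patch_closedI.
Qed.

End PatchSpace.

(** * Embeddings of patch spaces as spectral subspaces *)

Section PatchEmbedding.
Context (A B : eqType) (X Y : topologicalType).
Context (mX : X -> set A) (mY : Y -> set B) (f : X -> Y).
Hypotheses (pX : patch_space mX) (pY : patch_space mY).
Hypothesis f_compact_open : forall b,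
  open [set x | ~ mY (f x) b] /\ patch_closed mX [set x | ~ mY (f x) b].
(** This yields the injectivity of [f] and the continuity of its inverse on the range. *)
Hypothesis f_initial : forall a, exists b, forall x, mX x a <-> mY (f x) b.

(** Continuity for the patch topologies: the preimage of a subbasic set is patch closed by
    hypothesis, and so is its complement because open sets are patch open. *)
Let patch_limit_image (F : set_system X) (x : X) : UltraFilter F ->
  patch_limit mX F x -> patch_limit mY (f @ F) (f x).
Proof.
move=> FU Fx b; have [oK cK] := f_compact_open b; split=> [mb|Fmb].
  apply: contrapT => /(@ultra_setC _ _ _ (ultra_fmap f FU)) nFmb.
  exact: (cK F x FU nFmb Fx).
apply: contrapT => nmb; have Fn := patch_limit_open pX FU Fx oK nmb.
by have [y []] := filter_ex (filterI (Fmb : F (f @^-1` _)) Fn).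
Qed.

Let f_inj : injective f.
Proof.
move=> x y fxy; apply: (patch_inj pX); rewrite eqEsubset.
by split=> a; have [b fb] := f_initial a; rewrite !fb fxy.
Qed.

Let Z := range f.

Let preimage_val z : exists x, f x = set_val (z : set_type Z).
Proof. by have /set_mem[x _ fx] := valP z; exists x. Qed.

Let g (z : set_type Z) : X := projT1 (cid (preimage_val z)).

Let gK z : f (g z) = set_val z.
Proof. exact: projT2 (cid (preimage_val z)). Qed.

Let f' (x : X) : set_type Z := exist _ (f x) (mem_set (imageT f x)).

Let range_patch_space : patch_space (fun z : set_type Z => mY (set_val z)).
Proof.
split.
- by move=> b; exists [set y | ~ mY y b] => //; exact: patch_open.
- move=> V z [W oW <-] /= Wz; have [s nsz sW] := patch_subbase pY oW Wz.
  by exists s => // y /sW.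
(* The image of a patch compact space is patch compact: [F] is transported to [X] by [g], and a
   limit there is mapped back by [f]. *)
- move=> F FU; have [x Fx] := patch_limit_ex pX (ultra_fmap g FU).
  exists (f' x) => b /=.
  have : mY (f x) b <-> F [set z | mY (f (g z)) b].
    exact: (patch_limit_image (ultra_fmap g FU) Fx b).
  by under eq_set do rewrite gK.
- by move=> z1 z2 /(patch_inj pY)/val_inj.
Qed.

Lemma patch_spectral_subspace : spectral_subspace_upto_homeo X Y.
Proof.
exists Z.
  split; first exact: patch_generalized_spectral pY.
    exact: patch_generalized_spectral range_patch_space.
  move=> K /(patch_compact_openE pY)[oK cK].
  apply/(patch_compact_openE range_patch_space); split; first by exists K.
  move=> F z FU FK Fz; apply: (cK (set_val @ F)) => //; exact: ultra_fmap.
exists f', g; split.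
- by move=> x; apply: f_inj; rewrite gK.
- by move=> z; apply: val_inj; rewrite /= gK.
- apply/continuousP => _ [V oV <-].
  rewrite openE => x /= Vx; have [s nsx sV] := patch_subbase pY oV Vx.
  apply: filterS (_ : [set y | forall b, b \in s -> ~ mY (f y) b] `<=` _) _.
    by move=> y /sV.
  apply: filter_forall_seq => b /nsx nb.
  by apply: open_nbhs_nbhs; split=> //; exact: (f_compact_open b).1.
- apply/continuousP => V oV.
  rewrite openE => z /= Vz; have [s nsz sV] := patch_subbase pX oV Vz.
  apply: filterS (_ : [set y | forall a, a \in s -> ~ mX (g y) a] `<=` _) _.
    by move=> y /sV.
  apply: filter_forall_seq => a /nsz na; have [b fb] := f_initial a.
  apply: open_nbhs_nbhs; split=> //.
  exists [set y | ~ mY y b]; first exact: patch_open.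
  by apply/funext => y; rewrite /= -gK (propext (fb (g y))).
Qed.

End PatchEmbedding.

(** * Families of totally preordered groups *)

(** [cone_at x] is the nonnegative part of a total preorder on [M]; [cone_unit] is strictly positive
    at each point but need not dominate [M]. *)
Record cone_family (X : Type) (M : zmodType) : Type := ConeFamily {
  cone_at :> X -> set M;
  cone_unit : M;
  cone_atD : forall x a b, cone_at x a -> cone_at x b -> cone_at x (a + b);
  cone_at_total : forall x a, cone_at x a \/ cone_at x (- a);
  cone_unit_pos : forall x, cone_at x cone_unit;
  cone_unit_neg : forall x, ~ cone_at x (- cone_unit)
}.

Section ConeFamily.
Context (X : Type) (M : zmodType) (C : cone_family X M).
Implicit Types (x y : X) (a b c : M) (h k : X -> M).
Local Notation u := (cone_unit C).

Definition cle x a b : Prop := C x (b - a).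
Local Notation "a <=_ x b" := (cle x a b) (at level 70, x at level 0).
Definition ceq x a b : Prop := a <=_x b /\ b <=_x a.
Local Notation "a ~_ x b" := (ceq x a b) (at level 70, x at level 0).

Lemma cle_refl x a : a <=_x a.
Proof.
by rewrite /cle; have := cone_at_total C x (a - a); rewrite subrr oppr0 => -[].
Qed.

Lemma cle_trans b x a c : a <=_x b -> b <=_x c -> a <=_x c.
Proof. by move=> ab bc; have := cone_atD ab bc; rewrite /cle addrC subrKA. Qed.

Lemma cle_total x a b : a <=_x b \/ b <=_x a.
Proof. by have := cone_at_total C x (b - a); rewrite opprB. Qed.

Lemma cleD x a b c d : a <=_x b -> c <=_x d -> a + c <=_x b + d.
Proof. by move=> ab cd; have := cone_atD ab cd; rewrite /cle opprD addrACA. Qed.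

Lemma cleN x a b : a <=_x b -> - b <=_x - a.
Proof. by rewrite /cle opprK addrC. Qed.

Lemma ceq_refl x a : a ~_x a.
Proof. by split; exact: cle_refl. Qed.

Lemma ceq_sym x a b : a ~_x b -> b ~_x a.
Proof. by case. Qed.

Lemma ceq_trans b x a c : a ~_x b -> b ~_x c -> a ~_x c.
Proof. by move=> [ab ba] [bc cb]; split; exact: (@cle_trans b). Qed.

Lemma ceqD x a b c d : a ~_x b -> c ~_x d -> a + c ~_x b + d.
Proof. by move=> [ab ba] [cd dc]; split; exact: cleD. Qed.

Lemma ceqN x a b : a ~_x b -> - a ~_x - b.
Proof. by move=> [ab ba]; split; exact: cleN. Qed.

(* A choice of representatives for the quotient of [M] by the support
   [C x `&` - C x], which is totally ordered. *)
Definition crep x a : M := xget 0 [set b | a ~_x b].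

Lemma crepP x a : a ~_x crep x a.
Proof. by rewrite /crep; case: xgetP => [b _ //|/(_ a)[]]; exact: ceq_refl. Qed.

Lemma crepK x a : crep x a ~_x a.
Proof. exact/ceq_sym/crepP. Qed.

Lemma eq_crep x a b : a ~_x b -> crep x a = crep x b.
Proof.
move=> ab; rewrite /crep; congr xget; rewrite eqEsubset; split=> c /= ac.
  exact/(ceq_trans _ ac)/ceq_sym.
exact: ceq_trans ab ac.
Qed.

Lemma crep_id x a : crep x (crep x a) = crep x a.
Proof. exact/eq_crep/crepK. Qed.

Lemma crepDl x a b : crep x (crep x a + b) = crep x (a + b).
Proof. by apply: eq_crep; apply: ceqD; [exact: crepK|exact: ceq_refl]. Qed.

Lemma crepDr x a b : crep x (a + crep x b) = crep x (a + b).
Proof. by rewrite addrC crepDl addrC. Qed.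

Lemma cle_crepl x a b : crep x a <=_x b <-> a <=_x b.
Proof. by have [? ?] := crepP x a; split; exact: cle_trans. Qed.

Lemma cle_crepr x a b : a <=_x crep x b <-> a <=_x b.
Proof.
have [le1 le2] := crepP x b.
by split=> ab; [exact: cle_trans ab le2|exact: cle_trans ab le1].
Qed.

Definition cmin x a b : M := if `[< a <=_x b >] then a else b.
Definition cmax x a b : M := if `[< a <=_x b >] then b else a.

Lemma cle_min x a b c : c <=_x cmin x a b <-> c <=_x a /\ c <=_x b.
Proof.
rewrite /cmin; case: asboolP => ab; split=> [ca|[]//].
  by split=> //; exact: cle_trans ab.
by split=> //; case: (cle_total x a b) => // /(cle_trans ca).
Qed.

Lemma cle_max x a b c : cmax x a b <=_x c <-> a <=_x c /\ b <=_x c.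
Proof.
rewrite /cmax; case: asboolP => ab; split=> [ca|[]//].
  by split=> //; exact: cle_trans ca.
by split=> //; case: (cle_total x a b) => // ba; exact: cle_trans ca.
Qed.

Lemma cmin_or x a b : cmin x a b = a \/ cmin x a b = b.
Proof. by rewrite /cmin; case: ifP; [left|right]. Qed.

Lemma cmax_or x a b : cmax x a b = a \/ cmax x a b = b.
Proof. by rewrite /cmax; case: ifP; [right|left]. Qed.

(* Equivalently, [h] is a join of meets of elements of [s]; in this form the
   closure under the operations is immediate. *)
Definition cpiecewise h : Prop := exists s : seq M, forall x y,
  exists a, [/\ a \in s, h x <=_x a & a <=_y h y].

(** This bound makes [u] an order-unit of the group of functions. *)
Definition cbounded h : Prop :=
  exists n, forall x, - (u *+ n) <=_x h x /\ h x <=_x u *+ n.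

Definition cgood h : Prop := cpiecewise h /\ cbounded h.

Lemma cle_unit n x : 0 <=_x u *+ n.
Proof.
elim: n => [|n IHn]; first exact: cle_refl.
have /(cleD IHn) : 0 <=_x u by rewrite /cle subr0; exact: cone_unit_pos.
by rewrite addr0 mulrSr.
Qed.

Lemma cle_unitD n p x : u *+ n <=_x u *+ (n + p).
Proof.
by have := cleD (cle_refl x (u *+ n)) (cle_unit p x); rewrite addr0 mulrnDr.
Qed.

Lemma cpiecewise_eq h k : (forall x, h x ~_x k x) -> cpiecewise h -> cpiecewise k.
Proof.
move=> hk [s hs]; exists s => x y; have [a [sa ha ah]] := hs x y.
exists a; split=> //; first exact: cle_trans (hk x).2 ha.
exact: cle_trans ah (hk y).1.
Qed.

Lemma cpiecewise_const a : cpiecewise (fun=> a).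
Proof. by exists [:: a] => x y; exists a; split; rewrite ?inE//; exact: cle_refl. Qed.

Lemma cpiecewiseN h : cpiecewise h -> cpiecewise (fun x => - h x).
Proof.
(* Negation reverses both inequalities, so the witness for [(y, x)] is used. *)
move=> [s hs]; exists [seq - a | a <- s] => x y; have [a [sa ha ah]] := hs y x.
by exists (- a); split; [exact: map_f|exact: cleN|exact: cleN].
Qed.

Lemma cpiecewiseD h k :
  cpiecewise h -> cpiecewise k -> cpiecewise (fun x => h x + k x).
Proof.
move=> [s hs] [t kt]; exists [seq a + b | a <- s, b <- t] => x y.
have [a [sa ha ah]] := hs x y; have [b [tb kb bk]] := kt x y.
by exists (a + b); split; [exact: allpairs_f|exact: cleD|exact: cleD].
Qed.

(** The minimum at [y] is the value of [h] or of [k]; the witness of that function also works at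
    [x], where the minimum is below both. For the maximum the choice is made at [x]. *)
Lemma cpiecewise_min h k :
  cpiecewise h -> cpiecewise k -> cpiecewise (fun x => cmin x (h x) (k x)).
Proof.
move=> [s hs] [t kt]; exists (s ++ t) => x y.
have [minh mink] := (cle_min x _ _ _).1 (cle_refl x (cmin x (h x) (k x))).
have [->|->] := cmin_or y (h y) (k y).
  have [a [sa ha ah]] := hs x y; exists a; split=> //.
    by rewrite mem_cat sa.
  exact: cle_trans ha.
have [a [sa ha ah]] := kt x y; exists a; split=> //.
  by rewrite mem_cat sa orbT.
exact: cle_trans ha.
Qed.

Lemma cpiecewise_max h k :
  cpiecewise h -> cpiecewise k -> cpiecewise (fun x => cmax x (h x) (k x)).
Proof.
move=> [s hs] [t kt]; exists (s ++ t) => x y.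
have [maxh maxk] := (cle_max y _ _ _).1 (cle_refl y (cmax y (h y) (k y))).
have [->|->] := cmax_or x (h x) (k x).
  have [a [sa ha ah]] := hs x y; exists a; split=> //.
    by rewrite mem_cat sa.
  exact: cle_trans maxh.
have [a [sa ha ah]] := kt x y; exists a; split=> //.
  by rewrite mem_cat sa orbT.
exact: cle_trans maxk.
Qed.

Lemma cboundedW n p x a : - (u *+ n) <=_x a /\ a <=_x u *+ n ->
  - (u *+ (n + p)) <=_x a /\ a <=_x u *+ (n + p).
Proof.
move=> [na an]; split; last exact/(cle_trans an)/cle_unitD.
exact/(cle_trans _ na)/cleN/cle_unitD.
Qed.

Lemma cbounded2 h k : cbounded h -> cbounded k -> exists n, forall x,
  (- (u *+ n) <=_x h x /\ h x <=_x u *+ n) /\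
  (- (u *+ n) <=_x k x /\ k x <=_x u *+ n).
Proof.
move=> [n hn] [p kp]; exists (n + p)%N => x; split; first exact: cboundedW.
by rewrite addnC; exact: cboundedW.
Qed.

Lemma cgood_eq h k : (forall x, h x ~_x k x) -> cgood h -> cgood k.
Proof.
move=> hk [ph [n hn]]; split; first exact: cpiecewise_eq ph.
exists n => x; have [nh hn'] := hn x; have [hkx khx] := hk x.
by split; [exact: cle_trans hkx|exact: cle_trans hn'].
Qed.

Lemma cgood0 : cgood (fun=> 0).
Proof.
split; first exact: cpiecewise_const.
by exists 0 => x; rewrite mulr0n oppr0; split; exact: cle_refl.
Qed.

Lemma cgood_unit : cgood (fun=> u).
Proof.
split; first exact: cpiecewise_const.
exists 1 => x; rewrite mulr1n; split; last exact: cle_refl.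
apply: (@cle_trans 0); last exact: (cle_unit 1).
by rewrite -[0]oppr0; apply: cleN; exact: (cle_unit 1).
Qed.

Lemma cgoodN h : cgood h -> cgood (fun x => - h x).
Proof.
move=> [ph [n hn]]; split; first exact: cpiecewiseN.
exists n => x; have [nh hn'] := hn x.
by split; [exact: cleN|rewrite -[u *+ n]opprK; exact: cleN].
Qed.

Lemma cgoodD h k : cgood h -> cgood k -> cgood (fun x => h x + k x).
Proof.
move=> [ph bh] [pk bk]; split; first exact: cpiecewiseD.
have [n hkn] := cbounded2 bh bk; exists (n + n)%N => x.
have [[? ?] [? ?]] := hkn x.
by rewrite mulrnDr opprD; split; exact: cleD.
Qed.

Lemma cgood_min h k : cgood h -> cgood k -> cgood (fun x => cmin x (h x) (k x)).
Proof.
move=> [ph bh] [pk bk]; split; first exact: cpiecewise_min.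
have [n hkn] := cbounded2 bh bk; exists n => x; have [? ?] := hkn x.
by have [->|->] := cmin_or x (h x) (k x).
Qed.

Lemma cgood_max h k : cgood h -> cgood k -> cgood (fun x => cmax x (h x) (k x)).
Proof.
move=> [ph bh] [pk bk]; split; first exact: cpiecewise_max.
have [n hkn] := cbounded2 bh bk; exists n => x; have [? ?] := hkn x.
by have [->|->] := cmax_or x (h x) (k x).
Qed.

(** * The l-group of good functions and its points *)

Record cfun : Type := CFun {
  cfun_val :> X -> M;
  cfun_good : cgood cfun_val;
  cfun_rep : forall x, crep x (cfun_val x) = cfun_val x
}.

HB.instance Definition _ := gen_eqMixin cfun.
HB.instance Definition _ := gen_choiceMixin cfun.
Implicit Types e f g : cfun.

(** Values are chosen representatives modulo the supports, so equivalence at each point becomes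
    equality. *)
Lemma cfun_eqP f g : (forall x, f x ~_x g x) -> f = g.
Proof.
move=> fg; have {fg} : cfun_val f = cfun_val g.
  by apply/funext => x; rewrite -(cfun_rep f) -(cfun_rep g); exact: eq_crep.
case: f g => [f Gf rf] [g Gg rg] /= fg; case: g / fg in Gg rg *.
by congr CFun; exact: Prop_irrelevance.
Qed.

Lemma cfun_of_subproof h : cgood h -> cgood (fun x => crep x (h x)).
Proof. by apply: cgood_eq => x; exact: crepP. Qed.

Definition cfun_of h (Gh : cgood h) : cfun :=
  CFun (cfun_of_subproof Gh) (fun x => crep_id x (h x)).

Definition czero : cfun := cfun_of cgood0.
Definition copp f : cfun := cfun_of (cgoodN (cfun_good f)).
Definition cadd f g : cfun := cfun_of (cgoodD (cfun_good f) (cfun_good g)).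

Lemma caddA : associative cadd.
Proof.
by move=> f g e; apply: cfun_eqP => x; rewrite /= crepDr crepDl addrA; exact: ceq_refl.
Qed.

Lemma caddC : commutative cadd.
Proof. by move=> f g; apply: cfun_eqP => x; rewrite /= addrC; exact: ceq_refl. Qed.

Lemma cadd0 : left_id czero cadd.
Proof. by move=> f; apply: cfun_eqP => x; rewrite /= crepDl add0r; exact: crepK. Qed.

Lemma caddN : left_inverse czero copp cadd.
Proof.
by move=> f; apply: cfun_eqP => x; rewrite /= crepDl addNr; exact: ceq_refl.
Qed.

HB.instance Definition _ := GRing.isZmodule.Build cfun caddA caddC cadd0 caddN.

Definition cfun_le : rel cfun := fun f g => `[< forall x, f x <=_x g x >].
Definition cfun_min f g : cfun := cfun_of (cgood_min (cfun_good f) (cfun_good g)).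
Definition cfun_max f g : cfun := cfun_of (cgood_max (cfun_good f) (cfun_good g)).

Lemma cfun_le_refl : reflexive cfun_le.
Proof. by move=> f; apply/asboolP => x; exact: cle_refl. Qed.

Lemma cfun_le_anti : antisymmetric cfun_le.
Proof. by move=> f g /andP[/asboolP fg /asboolP gf]; apply: cfun_eqP. Qed.

Lemma cfun_le_trans : transitive cfun_le.
Proof.
move=> g f e /asboolP fg /asboolP gh; apply/asboolP => x.
exact: cle_trans (fg x) (gh x).
Qed.

Lemma cfun_le_min f g e :
  cfun_le f (cfun_min g e) = cfun_le f g && cfun_le f e.
Proof.
apply/asboolP/andP => [le_f|[/asboolP fg /asboolP fh] x].
  by split; apply/asboolP => x; have /cle_crepr/cle_min[] := le_f x.
by apply/cle_crepr/cle_min.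
Qed.

Lemma cfun_max_le f g e :
  cfun_le (cfun_max f g) e = cfun_le f e && cfun_le g e.
Proof.
apply/asboolP/andP => [le_h|[/asboolP fh /asboolP gh] x].
  by split; apply/asboolP => x; have /cle_crepl/cle_max[] := le_h x.
by apply/cle_crepl/cle_max.
Qed.

Definition cfun_order : lattice_order cfun :=
  LatticeOrder cfun_le_refl cfun_le_anti cfun_le_trans cfun_le_min cfun_max_le.

Lemma cfun_leD2l f g e : cfun_le g e -> cfun_le (f + g) (f + e).
Proof.
move=> /asboolP gh; apply/asboolP => x; apply/cle_crepl/cle_crepr/cleD => //.
exact: cle_refl.
Qed.

Definition cfun_lgroup : abLGroupType :=
  @AbLGroup cfun cfun_order cfun_leD2l.

Lemma cfun_order_unit : exists e : cfun_lgroup, order_unit e.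
Proof.
pose e : cfun_lgroup := cfun_of cgood_unit; exists e; split.
  apply/asboolP => x; apply/cle_crepl/cle_crepr; exact: (cle_unit 1).
move=> f; have [_ [n fn]] := cfun_good f; exists n; apply/asboolP => x.
apply: cle_trans (fn x).2 _.
(* Addition in [cfun] renormalizes values, so [e *+ n] takes the value [u *+ n] only up to
   equivalence. *)
elim: {fn} n => [|n IHn]; first by apply/cle_crepr; exact: cle_refl.
rewrite !mulrS; apply/cle_crepr/cleD => //.
by apply/cle_crepr; exact: cle_refl.
Qed.

Definition vanishing x : set cfun_lgroup := [set f : cfun | f x ~_x 0].

(** This is the kernel of evaluation at [x], with values in a totally ordered quotient of [M]; the
    unit does not vanish, so it is proper. *)
Lemma vanishing_prime x : prime_lgroup_ideal (vanishing x).
Proof.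
split.
- split; first split; last split.
  + exact: crepK.
  + move=> f g fx gx; apply: ceq_trans (crepK x _) _; rewrite -[0]addr0.
    apply: ceqD => //; apply: ceq_trans (crepK x _) _.
    by rewrite -[0]oppr0; exact: ceqN.
  + move=> f g fx gx; apply: ceq_trans (crepK x _) _.
    by have [->|->] := cmin_or x (f x) (g x).
  + move=> f g fx gx; apply: ceq_trans (crepK x _) _.
    by have [->|->] := cmax_or x (f x) (g x).
  + move=> f g e [_ f0] [e0 _] /asboolP fg /asboolP gh.
    by split; [exact: cle_trans (gh x) e0|exact: cle_trans f0 (fg x)].
- move=> VT; have : vanishing x (cfun_of cgood_unit) by rewrite VT.
  by move=> [/cle_crepl]; rewrite /cle sub0r => /(cone_unit_neg (c := C)).
- move=> f g fg; have {fg} := ceq_trans (crepP x _) fg.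
  by have [->|->] := cmin_or x (f x) (g x); [left|right].
Qed.

Definition vanishing_point x : lspectrum cfun_lgroup :=
  LSpectrum (vanishing_prime x).

(* [f] is the positive part of [- a], truncated at the unit. *)
Lemma vanishing_separates a : exists f, forall x, C x a <-> vanishing x f.
Proof.
pose h x := cmin x (cmax x (- a) 0) u.
have Gh : cgood h.
  split; first by apply: cpiecewise_min; [apply: cpiecewise_max|]; exact: cpiecewise_const.
  exists 1 => x; rewrite mulr1n.
  split; last by have [] := (cle_min x _ _ _).1 (cle_refl x (h x)).
  apply: (@cle_trans 0); first by rewrite -[0]oppr0; apply: cleN; exact: (cle_unit 1).
  apply/cle_min; split; last exact: (cle_unit 1).
  by have [] := (cle_max x _ _ _).1 (cle_refl x (cmax x (- a) 0)).
exists (cfun_of Gh) => x; split=> [Ca|].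
  apply: ceq_trans (crepK x _) _; split.
    apply: (@cle_trans (cmax x (- a) 0)).
      by have [] := (cle_min x _ _ _).1 (cle_refl x (h x)).
    by apply/cle_max; split; [rewrite /cle sub0r opprK|exact: cle_refl].
  apply/cle_min; split; last exact: (cle_unit 1).
  by have [] := (cle_max x _ _ _).1 (cle_refl x (cmax x (- a) 0)).
(* The minimum cannot be the unit, which is strictly positive; so it is the positive part of
   [- a]. *)
move=> [/cle_crepl + _]; rewrite /h; have [->|->] := cmin_or x (cmax x (- a) 0) u.
  by move=> /cle_max[]; rewrite /cle sub0r opprK.
by rewrite /cle sub0r => /(cone_unit_neg (c := C)).
Qed.

End ConeFamily.

(** * Cozero sets of good functions *)

Section PatchConeFamily.
Context (X : topologicalType) (M : zmodType) (C : cone_family X M).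
Hypothesis pC : patch_space C.
Local Notation "a <=_ x b" := (cle C x a b) (at level 70, x at level 0).

Let cle0 x a : a <=_x 0 <-> C x (- a).
Proof. by rewrite /cle sub0r. Qed.

(** A witness [a] for [(x, y)] is above [h x], hence positive at [x]; the finitely many such [a]
    stay positive near [x], and [a] is below [h y]. *)
Lemma cpiecewise_pos_open (h : X -> M) : cpiecewise C h ->
  open [set x | ~ h x <=_x 0].
Proof.
move=> [s hs]; rewrite openE => x /= hx.
apply: filterS (_ : [set y | forall a, a \in s -> h x <=_x a -> ~ a <=_y 0] `<=` _) _.
  move=> y sy; have [a [sa ha ah]] := hs x y => hy.
  by apply: (sy a sa ha); exact: cle_trans hy.
apply: filter_forall_seq => a sa; have [ha|nha] := pselect (h x <=_x a); last first.
  exact: filterS filterT.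
have : nbhs x [set y | ~ C y (- a)].
  apply: open_nbhs_nbhs; split; first exact: patch_open.
  by move=> /cle0 a0; apply: hx; exact: cle_trans a0.
by apply: filterS => y + _ /cle0.
Qed.

(** If [h] is nonpositive at the limit [y], the elements of [s] nonpositive at [y] are so [F]-almost
    everywhere; the witness for [(x, y)] is one of them and is above [h x]. *)
Lemma cpiecewise_pos_patch_closed (h : X -> M) : cpiecewise C h ->
  patch_closed C [set x | ~ h x <=_x 0].
Proof.
move=> [s hs] F y FU Fh Fy /= hy.
have : F [set x | forall a, a \in s -> a <=_y 0 -> a <=_x 0].
  apply: filter_forall_seq => a sa; have [/cle0/Fy Fa|na] := pselect (a <=_y 0).
    by apply: filterS Fa => x /cle0.
  exact: filterS filterT.
move=> /(filterI Fh)/filter_ex[x [/= hx sx]]; have [a [sa ha ah]] := hs x y.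
by apply: hx; apply: cle_trans ha _; apply: sx => //; exact: cle_trans hy.
Qed.

Lemma vanishing_compact_open (f : cfun_lgroup C) :
  open [set x | ~ lspectrum_set (vanishing_point C x) f] /\
  patch_closed C [set x | ~ lspectrum_set (vanishing_point C x) f].
Proof.
have [pf _] := cfun_good f; have pNf := cpiecewiseN pf.
have -> : [set x | ~ lspectrum_set (vanishing_point C x) f] =
    [set x | ~ cfun_val f x <=_x 0] `|` [set x | ~ - cfun_val f x <=_x 0].
  apply/funext => x; apply/propext; rewrite /= -not_andE.
  have -> : - cfun_val f x <=_x 0 <-> 0 <=_x cfun_val f x; last by [].
  by rewrite /cle sub0r opprK subr0.
split; first by apply: openU; exact: cpiecewise_pos_open.
by apply: patch_closedU; exact: cpiecewise_pos_patch_closed.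
Qed.

End PatchConeFamily.

(** * The l-spectrum *)

Section LSpectrumPatch.
Context (G : abLGroupType).

(** Closure conditions pass to the ultralimit of prime l-ideals, and primality does because
    ultrafilters split unions; the order-unit keeps the limit proper. *)
Lemma lspectrum_patch_space : (exists e : G, order_unit e) ->
  patch_space (@lspectrum_set G).
Proof.
move=> [e [e0 eG]]; split.
- move=> a; apply: hull_kernel_openP => P nPa; by exists a.
- move=> V P oV VP; have [k nk kV] := hull_kernel_openE oV VP.
  exists [:: k] => [a|Q h]; first by rewrite inE => /eqP ->.
  by apply/kV/h; rewrite inE.
- move=> F FU.
  pose p : set G := [set a | F [set P : lspectrum G | lspectrum_set P a]].
  have ideal (P : lspectrum G) : lgroup_ideal P.
    exact: prime_lgroup_ideal_ideal (lspectrumP P).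
  have pP : prime_lgroup_ideal p.
    split.
    + split; first split; last split.
      * by apply: filterS filterT => P _; have [[]] := ideal P.
      * move=> a b pa pb; apply: filterS (filterI pa pb) => P [].
        by have [[_ h] _] := ideal P; exact: h.
      * move=> a b pa pb; apply: filterS (filterI pa pb) => P [].
        by have [_ [h _ _]] := ideal P; exact: h.
      * move=> a b pa pb; apply: filterS (filterI pa pb) => P [].
        by have [_ [_ h _]] := ideal P; exact: h.
      * move=> a b c pa pc ab bc; apply: filterS (filterI pa pc) => P [Pa Pc].
        by have [_ [_ _ h]] := ideal P; exact: (h a b c).
    (* Some [P] would contain [e], hence its multiples and, by convexity, all of [G]. *)
    + move=> pT; have : p e by rewrite pT.
      move=> /filter_ex[P Pe]; have [_ PT _] := lspectrumP P; apply: PT.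
      have [[P0 PB] [_ _ Pc]] := ideal P.
      have Pn n : lspectrum_set P (e *+ n).
        elim: n => [|n IHn]; first by [].
        rewrite mulrS -[e *+ n]opprK; apply: (PB) => //.
        by rewrite -sub0r; exact: (PB).
      rewrite eqEsubset; split=> // a _.
      have [n an] := eG a; have [k ak] := eG (- a).
      apply: (Pc (0 - e *+ k) a _ _ (Pn n)) => //; first exact: PB.
      have := lgroup_leD2l (a - e *+ k) ak.
      by rewrite addrAC subrr sub0r subrK.
    + move=> a b pab.
      have : F ([set P : lspectrum G | lspectrum_set P a] `|`
          [set P : lspectrum G | lspectrum_set P b]).
        by apply: filterS pab => P; exact: (prime_lgroup_ideal_meet (lspectrumP P)).
      exact: ultra_setU.
  by exists (LSpectrum pP).
- move=> [P pP] [Q pQ] /= PQ; case: Q / PQ in pQ *.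
  by congr LSpectrum; exact: Prop_irrelevance.
Qed.

End LSpectrumPatch.

(** * From cone families to l-groups with order-unit *)

Lemma cone_family_spectral_subspace (X : topologicalType) (M : zmodType)
    (C : cone_family X M) : patch_space C ->
  exists2 G : abLGroupType, (exists e : G, order_unit e) &
    spectral_subspace_upto_homeo X (lspectrum G).
Proof.
move=> pC; exists (cfun_lgroup C); first exact: cfun_order_unit.
apply: (patch_spectral_subspace (f := vanishing_point C) pC).
- exact/lspectrum_patch_space/cfun_order_unit.
- exact: vanishing_compact_open.
- exact: vanishing_separates.
Qed.

(** * The real spectrum *)

Section RealSpectrum.
Context (R : comPzRingType).
Implicit Types (P : real_spectrum R) (a b : R).
Local Notation C := (@real_spectrum_set R).

Let isCone P : cone P.
Proof. exact: prime_cone_cone (real_spectrumP P). Qed.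

Let image_opp (S : set R) a : [set - x | x in S] a <-> S (- a).
Proof. by split=> [[x Sx <-]|Sa]; [rewrite opprK|exists (- a); rewrite ?opprK]. Qed.

Let total P a : C P a \/ C P (- a).
Proof.
have : (C P `|` [set - x | x in C P]) a.
  by rewrite (prime_cone_total (real_spectrumP P)).
by case=> [|/image_opp]; [left|right].
Qed.

Let supportE P a : (C P `&` [set - x | x in C P]) a <-> C P a /\ C P (- a).
Proof. by split=> -[Pa] /image_opp. Qed.

Let one_neg P : ~ C P (- 1).
Proof.
move=> PN1; have [_ _ [[sub PM] PT _]] := real_spectrumP P; apply: PT.
rewrite eqEsubset; split=> // a _; rewrite -[a]mulr1; apply: (PM).
by apply/supportE; split=> //; exact: cone1.
Qed.

Definition real_cone_family : cone_family (real_spectrum R) R :=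
  @ConeFamily _ R C 1 (fun P a b => @coneD _ _ (isCone P) a b) total
    (fun P => cone1 (isCone P)) one_neg.

Lemma real_spectrum_patch_space : patch_space (real_spectrum_set (R := R)).
Proof.
split.
- move=> a; exists [set [set P | ~ C P a]]; last by rewrite bigcup_set1.
  by move=> _ ->; apply: (finI_from1 id); exists a.
- move=> V P [D sD <-] [B DB BP].
  have [E sE BE] := sD B DB; rewrite -BE in BP.
  have {}BP : forall U, [set` E] U -> U P by exact: BP.
  (* An element defining each subbasic set; the default [0] only concerns sets that are not
     subbasic. *)
  pose w (U : set (real_spectrum R)) : R :=
    xget 0 [set a | U = [set Q : real_spectrum R | ~ C Q a]].
  have wP U : [set` E] U -> U = [set Q | ~ C Q (w U)].
    by move=> /sE/set_mem[a Ua]; rewrite /w; case: xgetP => [b _ //|/(_ a)].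
  exists [seq w U | U <- enum_fset E] => [_ /mapP[U UE ->]|Q h].
    by have := BP U UE; rewrite {1}(wP U UE).
  exists B => //; rewrite -BE.
  suff : forall U, [set` E] U -> U Q by [].
  move=> U UE; rewrite (wP U UE) /=.
  by apply: h; exact: map_f.
- move=> F FU; pose p : set R := [set a | F [set P | C P a]].
  (* Lying in the support is a conjunction of two memberships, so it commutes with ultralimits. *)
  have suppE a : (p `&` [set - x | x in p]) a <->
      F [set P | (C P `&` [set - x | x in C P]) a].
    split=> [[pa /image_opp pNa]|Fa].
      by apply: filterS (filterI pa pNa) => P /supportE.
    split; first by apply: filterS Fa => P [].
    by apply/image_opp; apply: filterS Fa => P /supportE[].
  have pP : prime_cone p.
    split.
    + split.
      * by apply: filterS filterT => P _; exact: cone0.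
      * by move=> a b pa pb; apply: filterS (filterI pa pb) => P []; exact: coneD.
      * by apply: filterS filterT => P _; exact: cone1.
      * by move=> a b pa pb; apply: filterS (filterI pa pb) => P []; exact: coneM.
      * by move=> a; apply: filterS filterT => P _; exact: cone_sqr.
    + rewrite eqEsubset; split=> // a _.
      have : F ([set P | C P a] `|` [set P | C P (- a)]).
        by apply: filterS filterT => P _; exact: total.
      by move=> /ultra_setU[Fa|Fa]; [left|right; apply/image_opp].
    + have support P := prime_cone_support (real_spectrumP P).
      split; first (split; first split).
      * apply/suppE; apply: filterS filterT => P _.
        by have [[[h _] _] _ _] := support P.
      * move=> a b /suppE pa /suppE pb; apply/suppE.
        apply: filterS (filterI pa pb) => P [].
        by have [[[_ h] _] _ _] := support P; exact: h.
      * move=> a b /suppE pb; apply/suppE; apply: filterS pb => P.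
        by have [[_ h] _ _] := support P; exact: h.
      * move=> pT; have /suppE/filter_ex[P /supportE[_]] :
          (p `&` [set - x | x in p]) 1 by rewrite pT.
        exact: one_neg.
      * move=> a b /suppE pab.
        have : F ([set P | (C P `&` [set - x | x in C P]) a] `|`
            [set P | (C P `&` [set - x | x in C P]) b]).
          apply: filterS pab => P; exact: (prime_ring_idealM (support P)).
        by move=> /ultra_setU[|] /suppE; [left|right].
  by exists (RealSpectrum pP).
- move=> [P pP] [Q pQ] /= PQ; case: Q / PQ in pQ *.
  by congr RealSpectrum; exact: Prop_irrelevance.
Qed.

End RealSpectrum.

(** * The Brumfiel spectrum *)

Section FRing.
Context (A : comFRingType).
Implicit Types a b c : A.

Lemma fring_leD a b c d : a <= b -> c <= d -> a + c <= b + d.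
Proof.
move=> ab cd; apply: (le_trans (fring_leD2l a cd)).
by rewrite addrC [b + d]addrC; exact: fring_leD2l.
Qed.

Lemma fring_subr_ge0 a b : a <= b -> 0 <= b - a.
Proof. by move=> /(fring_leD2l (- a)); rewrite addNr addrC. Qed.

Lemma fring_mulr_ge0 a b : 0 <= a -> 0 <= b -> 0 <= a * b.
Proof. by move=> a0 /(fring_leM2l a0); rewrite mulr0. Qed.

Definition fpos a : A := Order.join a 0.

Lemma fpos_ge0 a : 0 <= fpos a.
Proof. exact: leUr. Qed.

Lemma fpos_ge a : a <= fpos a.
Proof. exact: leUl. Qed.

Lemma fpos_le a b : a <= b -> 0 <= b -> fpos a <= b.
Proof. by move=> ab b0; rewrite /fpos leUx ab b0. Qed.

Lemma fposB a : fpos a - fpos (- a) = a.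
Proof.
apply/eqP; rewrite subr_eq; apply/eqP/le_anti/andP; split.
  apply: fpos_le; first by have := fring_leD2l a (fpos_ge0 (- a)); rewrite addr0.
  by have := fring_leD2l a (fpos_ge (- a)); rewrite subrr.
have : fpos (- a) <= - a + fpos a.
  apply: fpos_le; first by have := fring_leD2l (- a) (fpos_ge0 a); rewrite addr0.
  by have := fring_leD2l (- a) (fpos_ge a); rewrite addNr.
by move=> /(fring_leD2l a); rewrite addrA subrr add0r.
Qed.

(** With [m] the meet, both [0] and [a = fpos a - fpos (- a)] are below [fpos a - m]; hence so is
    [fpos a], and [m <= 0]. *)
Lemma fposI a : Order.meet (fpos a) (fpos (- a)) = 0.
Proof.
set m := Order.meet _ _; apply: le_anti; apply/andP; split; last first.
  by rewrite lexI !fpos_ge0.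
have mp : m <= fpos a by exact: leIl.
have mn : m <= fpos (- a) by exact: leIr.
have /(fring_leD2l (m - fpos a)) : fpos a <= fpos a - m.
  apply: fpos_le; last exact: fring_subr_ge0.
  have /(fring_leD2l a) := fring_subr_ge0 mn.
  by rewrite addr0 addrA -{2}(fposB a) subrK.
by rewrite subrK addrA subrK subrr.
Qed.

(** The f-ring law applies twice: [fpos a] is disjoint from its product with [fpos (- a)], and then
    this product is disjoint from itself. *)
Lemma fposM0 a : fpos a * fpos (- a) = 0.
Proof.
have h1 : Order.meet (fpos a) (fpos (- a) * fpos a) = 0.
  by apply: fring_meetM (fposI a); exact: fpos_ge0.
rewrite meetC in h1; have := fring_meetM _ (fpos_ge0 a) (fpos_ge0 (- a)) h1.
rewrite [fpos (- a) * _]mulrC meetxx; apply.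
exact/fring_mulr_ge0/fpos_ge0/fpos_ge0.
Qed.

(** Squaring [1 = fpos 1 - fpos (- 1)] kills the cross terms and leaves a sum of two squares of
    nonnegative elements. *)
Lemma fring_ler01 : 0 <= 1 :> A.
Proof.
have -> : 1 = fpos 1 * fpos 1 + fpos (- 1) * fpos (- 1) :> A.
  rewrite -[LHS]mulr1 -{1 2}(fposB 1) mulrBl !mulrBr fposM0.
  by rewrite [_ * fpos 1 in X in _ - X]mulrC fposM0 subr0 sub0r opprK.
by rewrite -[0]addr0; apply: fring_leD; apply: fring_mulr_ge0; exact: fpos_ge0.
Qed.

End FRing.

(** * Prime l-ideals of an f-ring as cones *)

Section BrumfielSpectrum.
Context (A : comFRingType).
Implicit Types (P Q : brumfiel_spectrum A) (a b : A).
Local Notation ideal P := (prime_fring_ideal_ideal (brumfiel_spectrumP P)).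

Let contains P : set A := brumfiel_spectrum_set P.

(* The preimage in [A] of the positive cone of [A / P]. *)
Definition brumfiel_cone P : set A := [set a | contains P (fpos (- a))].

Lemma brumfiel_coneE P a :
  contains P a <-> brumfiel_cone P a /\ brumfiel_cone P (- a).
Proof.
have [[[P0 PB] _] [_ Pj _]] := ideal P.
rewrite /brumfiel_cone /= opprK; split=> [Pa|[PNa Pa]].
  by split; apply: Pj => //; rewrite -sub0r; exact: PB.
by rewrite -(fposB a); exact: PB.
Qed.

(** Convexity applies, as [fpos (- (a + b))] lies between [0] and [fpos (- a) + fpos (- b)]. *)
Lemma brumfiel_coneD P a b :
  brumfiel_cone P a -> brumfiel_cone P b -> brumfiel_cone P (a + b).
Proof.
have [[[P0 PB] _] [_ _ Pc]] := ideal P; rewrite /brumfiel_cone /= => Pa Pb.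
apply: (Pc 0 _ (fpos (- a) + fpos (- b))) => //; last 2 first.
- exact: fpos_ge0.
- rewrite opprD; apply: fpos_le; first by apply: fring_leD; exact: fpos_ge.
  by rewrite -[0]addr0; apply: fring_leD; exact: fpos_ge0.
rewrite -[fpos (- b)]opprK; apply: (PB) => //.
by rewrite -sub0r; exact: PB.
Qed.

(** The positive and negative parts of [a] have product [0], and [P] is prime. *)
Lemma brumfiel_cone_total P a : brumfiel_cone P a \/ brumfiel_cone P (- a).
Proof.
have [[[P0 _] _] _] := ideal P; rewrite /brumfiel_cone /= opprK.
have := prime_fring_idealM (brumfiel_spectrumP P) (x := fpos a) (y := fpos (- a)).
by rewrite fposM0 => /(_ P0)[]; [right|left].
Qed.

Lemma brumfiel_cone1 P : brumfiel_cone P 1.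
Proof.
have [[[P0 _] _] _] := ideal P; rewrite /brumfiel_cone /=.
rewrite (_ : fpos (- 1) = 0) //; apply/join_r.
by have := fring_leD2l (- 1) (fring_ler01 A); rewrite addr0 addNr.
Qed.

Lemma brumfiel_coneN1 P : ~ brumfiel_cone P (- 1).
Proof.
rewrite /brumfiel_cone /= opprK => P1.
have [[[P0 _] PM] [_ _ Pc]] := ideal P.
apply: (prime_fring_ideal_proper (brumfiel_spectrumP P)).
rewrite eqEsubset; split=> // a _; rewrite -[a]mulr1; apply: (PM).
by apply: (Pc 0 1 (fpos 1)) => //; [exact: fring_ler01|exact: fpos_ge].
Qed.

Definition brumfiel_cone_family : cone_family (brumfiel_spectrum A) A :=
  ConeFamily brumfiel_coneD brumfiel_cone_total brumfiel_cone1 brumfiel_coneN1.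

Lemma brumfiel_patch_space : patch_space brumfiel_cone.
Proof.
split.
- by move=> a; apply: hull_kernel_openP => P nPa; exists (fpos (- a)).
- move=> V P oV VP; have [k nk kV] := hull_kernel_openE oV VP.
  (* Being outside [P], [k] has a strict sign there: [k] or [- k] is outside the cone, and this one
     condition at [Q] keeps [k] out of [Q]. *)
  have [Ck|nCk] := pselect (brumfiel_cone P k).
    exists [:: - k] => [a|Q h].
      by rewrite inE => /eqP -> CNk; apply: nk; exact/brumfiel_coneE.
    apply: kV => /brumfiel_coneE[_ CNk]; exact: h (mem_head _ _) CNk.
  exists [:: k] => [a|Q h]; first by rewrite inE => /eqP ->.
  apply: kV => /brumfiel_coneE[CQk _]; exact: h (mem_head _ _) CQk.
- move=> F FU; pose p : set A := [set a | F [set P | contains P a]].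
  have pP : prime_fring_ideal p.
    split.
    + split; first (split; first split); last split.
      * by apply: filterS filterT => P _; have [[[h _] _] _] := ideal P.
      * move=> a b pa pb; apply: filterS (filterI pa pb) => P [].
        by have [[[_ h] _] _] := ideal P; exact: h.
      * move=> a b pb; apply: filterS pb => P.
        by have [[_ h] _] := ideal P; exact: h.
      * move=> a b pa pb; apply: filterS (filterI pa pb) => P [].
        by have [_ [h _ _]] := ideal P; exact: h.
      * move=> a b pa pb; apply: filterS (filterI pa pb) => P [].
        by have [_ [_ h _]] := ideal P; exact: h.
      * move=> a b c pa pc ab bc; apply: filterS (filterI pa pc) => P [Pa Pc].
        by have [_ [_ _ h]] := ideal P; exact: (h a b c).
    + move=> pT; have : p 1 by rewrite pT.
      by move=> /filter_ex[P /brumfiel_coneE[_]]; exact: brumfiel_coneN1.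
    + move=> a b pab.
      have : F ([set P | contains P a] `|` [set P | contains P b]).
        by apply: filterS pab => P; exact: (prime_fring_idealM (brumfiel_spectrumP P)).
      exact: ultra_setU.
  (* The limit of the ideals is the limit of the cones, since [a] is in the cone exactly when
     [fpos (- a)] is in the ideal. *)
  by exists (BrumfielSpectrum pP).
- move=> P Q PQ.
  have {PQ} : contains P = contains Q.
    apply/funext => a.
    by rewrite (propext (brumfiel_coneE P a)) (propext (brumfiel_coneE Q a)) PQ.
  case: P Q => [P pP] [Q pQ] /= PQ; case: Q / PQ in pQ *.
  by congr BrumfielSpectrum; exact: Prop_irrelevance.
Qed.

End BrumfielSpectrum.

Theorem corollary5p7 :
  (forall A : comFRingType,
     exists2 G : abLGroupType, (exists u : G, order_unit u) &
       spectral_subspace_upto_homeo (brumfiel_spectrum A) (lspectrum G)) /\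
  (forall R : comPzRingType,
     exists2 G : abLGroupType, (exists u : G, order_unit u) &
       spectral_subspace_upto_homeo (real_spectrum R) (lspectrum G)).
Proof.
split=> [A|R].
  exact: (cone_family_spectral_subspace (C := brumfiel_cone_family A)
    (brumfiel_patch_space A)).
exact: (cone_family_spectral_subspace (C := real_cone_family R)
  (real_spectrum_patch_space R)).
Qed.
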